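(* Let $G$ be a graph of order $n\ge 2$. Then $\mathrm{gp}^{\rightarrow}(G)$ equals the largest order of an induced subgraph $H$ of $G$ that is a comparability graph ($H$ may be disconnected).
   Context: Graphs are finite and simple. An orientation of a graph $G$ is a digraph obtained by assigning exactly one direction to each edge of $G$. For a digraph $D$, a set $S\subseteq V(D)$ is in general position if for any $u,v\in S$ no shortest directed $u,v$-path in $D$ passes through a vertex of $S\setminus\{u,v\}$; $\mathrm{gp}(D)$ is the maximum cardinality of a general position set of $D$. The upper oriented general position number $\mathrm{gp}^{\rightarrow}(G)$ is the maximum of $\mathrm{gp}(D)$ over all orientations $D$ of $G$. A digraph is transitive if $x\to y$ and $y\to z$ imply $x\to z$; a graph is a comparability graph if it admits a transitive orientation. *)

(* Defs.v *)
From HB Require Import structures.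
From mathcomp Require Import all_boot.
From mathcomp Require Import boolp.

Set Implicit Arguments.
Unset Strict Implicit.
Unset Printing Implicit Defensive.

(* The maxima below range over Prop-valued properties of the elements of a
   finite type; `[< P >] (from boolp) is the classical boolean value of P. *)

Record sgraph := SGraph {
  vertex :> finType;
  edge : rel vertex;
  edge_sym : symmetric edge;
  edge_irrefl : irreflexive edge
}.

(* A digraph on the vertex set T is given by its set of arcs. *)
Definition digraph (T : finType) := {set T * T}.

Definition arc (T : finType) (D : digraph T) : rel T :=
  [rel x y | (x, y) \in D].

Definition orientation (G : sgraph) (D : digraph G) : Prop :=
  (forall x y : G, arc D x y -> edge x y) /\
  (forall x y : G, edge x y -> arc D x y (+) arc D y x).

Definition comparability (G : sgraph) : Prop :=
  exists D : digraph G, orientation D /\ transitive (arc D).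

Section Induced.
Variables (G : sgraph) (S : {set G}).

Definition induced_edge : rel {x : G | x \in S} :=
  [rel x y | edge (val x) (val y)].

Lemma induced_edge_sym : symmetric induced_edge.
Proof. by move=> x y; apply: edge_sym. Qed.

Lemma induced_edge_irrefl : irreflexive induced_edge.
Proof. by move=> x; apply: edge_irrefl. Qed.

Definition induced : sgraph := SGraph induced_edge_sym induced_edge_irrefl.
End Induced.

Section GeneralPosition.
Variables (T : finType) (D : digraph T).

(* Repeated vertices need not be excluded explicitly: a walk of minimum length
   has none. The length of the path u :: p is size p. *)
Definition shortest_path (u v : T) (p : seq T) : Prop :=
  [/\ path (arc D) u p, last u p = v &
      forall q, path (arc D) u q -> last u q = v -> size p <= size q].

Definition general_position (S : {set T}) : Prop :=
  forall u v, u \in S -> v \in S ->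
  forall p, shortest_path u v p ->
  forall w, w \in S :\: [set u; v] -> w \notin u :: p.

Definition gp : nat := \max_(S : {set T} | `[< general_position S >]) #|S|.
End GeneralPosition.

Definition upper_gp (G : sgraph) : nat :=
  \max_(D : digraph G | `[< orientation D >]) gp D.

(* Main.v *)
Require Import Defs.
From mathcomp Require Import all_boot.
From mathcomp Require Import boolp.

(** In an oriented graph, a set in general position carries a transitive
    relation: if x -> y -> z inside S and x -> z were missing, then x, y, z
    would be a shortest path with inner vertex y in S
    ([general_position_transitive]). So a general position set induces a
    comparability graph, whatever the orientation.

    Conversely, a transitive orientation of the subgraph induced by S extends
    to the whole graph so that every edge between S and its complement leaves S
    ([extend_orientation]). A directed path ending in S then never leaves S, so
    transitivity shortcuts it to a single arc, and no shortest path between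
    vertices of S has an inner vertex ([transitive_general_position]).

    Hence the same vertex sets compete in both maxima. *)

(* The name arc also denotes the arcs of a cyclic sequence in path. *)
Local Notation arc := Defs.arc.

(** A length-two walk x -> y -> z without the arc x -> z is a shortest path; the
    absence of 2-cycles in an orientation guarantees that its ends differ. *)
Lemma general_position_transitive {G : sgraph} {D : digraph G} {S : {set G}} :
  orientation D -> general_position D S -> {in S & &, transitive (arc D)}.
Proof.
move=> [sDE oD] gpS y x z yS xS zS xy yz.
have arc_neq a b : arc D a b -> a != b.
  by move=> /sDE ab; apply: contraTneq ab => ->; rewrite edge_irrefl.
have xNz : x != z.
  apply: contraTneq yz => <-; apply/negP => yx.
  by have := oD _ _ (sDE _ _ xy); rewrite xy yx.
apply: contraT => xzN.
have short : shortest_path D x z [:: y; z].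
  split=> /=; rewrite ?xy ?yz // => -[|a [|b q]] //=.
    by move=> _ /eqP; rewrite (negPf xNz).
  by rewrite andbT => xa az; rewrite az (negPf xzN) in xa.
have yin : y \in S :\: [set x; z].
  by rewrite !inE yS andbT negb_or eq_sym (arc_neq _ _ xy) (arc_neq _ _ yz).
by have := gpS x z xS zS _ short y yin; rewrite !inE eqxx orbT.
Qed.

Lemma path_in_initial {T : finType} {D : digraph T} {S : {set T}} :
  (forall x y, arc D x y -> y \in S -> x \in S) ->
  forall u p, path (arc D) u p -> last u p \in S -> all [in S] (u :: p).
Proof.
move=> initS u p; elim: p u => [|v p IHp] u /=; first by move=> _ ->.
move=> /andP[uv vp] /(IHp v vp) /= /andP[vS pS].
by rewrite (initS _ _ uv vS) vS.
Qed.

(** A path between vertices of S stays in S because S is closed under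
    predecessors, so transitivity replaces it by one arc: shortest paths have
    length at most one. *)
Lemma transitive_general_position {T : finType} {D : digraph T} {S : {set T}} :
  (forall x y, arc D x y -> y \in S -> x \in S) ->
  {in S & &, transitive (arc D)} -> general_position D S.
Proof.
move=> initS trS u v uS vS p [up lastp minp] w.
rewrite !inE negb_or => /andP[/andP[wNu wNv] _]; rewrite (negPf wNu) /=.
case: p => [|a p] // in up lastp minp *.
have inS : all [in S] (u :: a :: p).
  by apply: path_in_initial up _; rewrite // lastp.
have uv : arc D u v.
  have /allP := order_path_min_in trS inS up; apply.
  by rewrite -lastp /= mem_last.
have := minp [:: v]; rewrite /= uv => /(_ isT erefl).
by case: p lastp {up minp inS} => //= ->; rewrite inE.
Qed.

Section Extension.
Context {G : sgraph} {S : {set G}} (D : digraph (induced S)).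

(** No arc enters S from outside: S is closed under predecessors. The order
    [enum_rank] serves only to choose one direction for each edge of the
    complement. *)
Definition extend_orientation : digraph G :=
  [set (val p.1, val p.2) | p in D] :|:
  [set p | [&& edge p.1 p.2, p.2 \notin S &
            (p.1 \in S) || (enum_rank p.1 < enum_rank p.2)]].

Lemma arc_extend_in (x y : induced S) :
  arc extend_orientation (val x) (val y) = arc D x y.
Proof.
rewrite /arc /= !inE /= (valP y) andbF orbF.
apply/imsetP/idP => [[[a b] abD [/val_inj-> /val_inj->]] //|xyD].
by exists (x, y).
Qed.

Lemma arc_extend_out (x y : G) : y \notin S ->
  arc extend_orientation x y =
  edge x y && ((x \in S) || (enum_rank x < enum_rank y)).
Proof.
move=> yNS; rewrite /arc /= !inE /= yNS /=.
case: imsetP => [[[a b] _ [_ eqy]]|//].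
by rewrite eqy (valP b) in yNS.
Qed.

Lemma extend_orientation_initial {x y : G} :
  arc extend_orientation x y -> y \in S -> x \in S.
Proof.
move=> + yS; rewrite /arc /= !inE /= yS andbF orbF.
by move=> /imsetP[[a b] _ [-> _]]; apply: valP.
Qed.

Lemma extend_orientation_transitive :
  transitive (arc D) -> {in S & &, transitive (arc extend_orientation)}.
Proof.
move=> trD y x z yS xS zS.
rewrite -[x]/(val (exist _ x xS : induced S)).
rewrite -[y]/(val (exist _ y yS : induced S)).
rewrite -[z]/(val (exist _ z zS : induced S)).
by rewrite !arc_extend_in; apply: trD.
Qed.

Lemma extend_orientationP : orientation D -> orientation extend_orientation.
Proof.
move=> [sDE oD]; split=> x y.
  have [yS xy|yNS] := boolP (y \in S); last first.
    by rewrite arc_extend_out // => /andP[].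
  have xS := extend_orientation_initial xy yS.
  apply: (sDE (exist _ x xS) (exist _ y yS)).
  by rewrite -arc_extend_in.
move=> xy.
have leaves a b : a \in S -> b \notin S -> arc extend_orientation b a = false.
  by move=> aS /negP bNS; apply/negP => /extend_orientation_initial /(_ aS).
have [xS|xNS] := boolP (x \in S); have [yS|yNS] := boolP (y \in S).
- have := oD (exist _ x xS) (exist _ y yS) xy.
  by rewrite -!arc_extend_in.
- by rewrite (leaves x y) // arc_extend_out // xy xS.
- by rewrite (leaves y x) // arc_extend_out // edge_sym xy yS.
- rewrite !arc_extend_out // (edge_sym y) xy (negPf xNS) (negPf yNS) /=.
  case: ltngtP => // /val_inj /enum_rank_inj eqxy.
  by rewrite eqxy edge_irrefl in xy.
Qed.

End Extension.

Lemma general_position_comparability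
    {G : sgraph} {D : digraph G} {S : {set G}} :
  orientation D -> general_position D S -> comparability (induced S).
Proof.
move=> oriD gpS; have trS := general_position_transitive oriD gpS.
have [sDE oD] := oriD.
pose DS : digraph (induced S) := [set p | arc D (val p.1) (val p.2)].
have arcDS x y : arc DS x y = arc D (val x) (val y) by rewrite {1}/arc /= inE.
exists DS; split; first split=> x y.
- by rewrite arcDS => /sDE.
- by rewrite !arcDS => /oD.
- by move=> y x z; rewrite !arcDS; apply: trS; apply: valP.
Qed.

Lemma comparability_general_position {G : sgraph} {S : {set G}} :
  comparability (induced S) ->
  exists D : digraph G, orientation D /\ general_position D S.
Proof.
move=> [D [oD trD]]; exists (extend_orientation D).
split; first exact: extend_orientationP.
apply: transitive_general_position; first exact: extend_orientation_initial.
exact: extend_orientation_transitive.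
Qed.

Theorem theorem4p4 (G : sgraph) (hn : 2 <= #|G|) :
  upper_gp G =
  \max_(S : {set G} | `[< comparability (induced S) >]) #|induced S|.
Proof.
have cardS (S : {set G}) : #|induced S| = #|S| by rewrite card_sig.
apply/eqP; rewrite eqn_leq; apply/andP; split.
  apply/bigmax_leqP => D /asboolP oD; apply/bigmax_leqP => S /asboolP gpS.
  apply: (bigmax_sup S); last by rewrite cardS.
  by apply/asboolP; apply: general_position_comparability gpS.
apply/bigmax_leqP => S /asboolP /comparability_general_position[D [oD gpS]].
rewrite cardS; apply: (bigmax_sup D); first exact/asboolP.
by apply: (bigmax_sup S) => //; apply/asboolP.
Qed.
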